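(* Let $(N,w)$ be a cooperative interval game. Then $(N,w)$ is selection superadditive if and only if for every $S,T \in 2^N$ such that $S\cap T=\emptyset$, $S\neq\emptyset$, $T\neq\emptyset$ we have $$\overline{w}(S)+\overline{w}(T) \le \underline{w}(S\cup T).$$
   Context: Let $N=\{1,2,\ldots,n\}$ be a set of players, let $2^N$ be the power set of $N$, and let $\mathbb{IR}$ be the set of all closed real intervals $X=[\underline{X},\overline{X}]=\{x\in\mathbb{R}: \underline{X}\le x\le \overline{X}\}$. A (classical) cooperative game is a pair $(N,v)$ with $v:2^N\to\mathbb{R}$ and $v(\emptyset)=0$. A cooperative interval game is a pair $(N,w)$ with $w:2^N\to\mathbb{IR}$ and $w(\emptyset)=[0,0]$. Write $\underline{w}(S)$ and $\overline{w}(S)$ for the lower and upper bound of the interval $w(S)$. A selection of $(N,w)$ is a cooperative game $(N,v)$ with $v(S)\in w(S)$ for every $S\in 2^N$. A cooperative game $(N,v)$ is superadditive if $v(T)+v(S)\le v(S\cup T)$ for every $S,T\subseteq N$ with $S\cap T=\emptyset$. An interval game is selection superadditive if all its selections are superadditive games. *)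

(* Defs.v *)
From mathcomp Require Import all_boot all_order all_algebra.
From mathcomp Require Import reals.

Set Implicit Arguments.
Unset Strict Implicit.
Unset Printing Implicit Defensive.

Import Order.TTheory GRing.Theory Num.Theory.
Local Open Scope ring_scope.

(* Closed real intervals are nonempty, so they are determined by their two
   bounds. *)
Record closed_interval (R : realType) := ClosedInterval {
  lower : R;
  upper : R;
  lower_le_upper : lower <= upper
}.

Definition itv_of (R : realType) (X : closed_interval R) : interval R :=
  `[lower X, upper X].

Definition itv_zero (R : realType) : closed_interval R :=
  ClosedInterval (lexx (0 : R)).

(* The player set {1, ..., n} is rendered as 'I_n = {0, ..., n - 1}. *)
Record coop_game (R : realType) (n : nat) := CoopGame {
  worth :> {set 'I_n} -> R;
  worth_set0 : worth set0 = 0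
}.

Record interval_game (R : realType) (n : nat) := IntervalGame {
  iworth :> {set 'I_n} -> closed_interval R;
  iworth_set0 : iworth set0 = itv_zero R
}.

Definition selection (R : realType) (n : nat)
    (w : interval_game R n) (v : coop_game R n) : Prop :=
  forall S : {set 'I_n}, v S \in itv_of (w S).

Definition superadditive (R : realType) (n : nat) (v : coop_game R n) : Prop :=
  forall S T : {set 'I_n}, S :&: T = set0 -> v T + v S <= v (S :|: T).

Definition selection_superadditive (R : realType) (n : nat)
    (w : interval_game R n) : Prop :=
  forall v : coop_game R n, selection w v -> superadditive v.

(* Main.v *)
(** If the inequality fails for [S] and [T], the game taking the lower bound at
    [S :|: T] and the upper bound at every other coalition is a selection that
    is not superadditive. *)
Require Import Defs.
From mathcomp Require Import all_boot all_order all_algebra.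
From mathcomp Require Import reals.

Import Order.TTheory GRing.Theory Num.Theory.

Local Open Scope ring_scope.

(** For a selection [v], the sum [v S + v T] is at most the sum of the upper bounds, hence at most
    the lower bound at [S :|: T], hence at most [v (S :|: T)]. Conversely, superadditivity of
    [low_at w (S :|: T)] at [S], [T] is exactly the required inequality, since neither coalition
    equals the union. *)

Lemma selectionP {R : realType} {n : nat} (w : interval_game R n)
    (v : coop_game R n) :
  selection w v <-> forall S, lower (w S) <= v S <= upper (w S).
Proof. by split=> vw S; have := vw S; rewrite /itv_of in_itv. Qed.

Definition low_at_worth {R : realType} {n : nat} (w : interval_game R n)
    (U S : {set 'I_n}) : R :=
  if S == U then lower (w S) else upper (w S).

Lemma low_at_worth0 {R : realType} {n : nat} (w : interval_game R n)
    (U : {set 'I_n}) : low_at_worth w U set0 = 0.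
Proof. by rewrite /low_at_worth iworth_set0 if_same. Qed.

Definition low_at {R : realType} {n : nat} (w : interval_game R n)
    (U : {set 'I_n}) : coop_game R n :=
  CoopGame (low_at_worth0 w U).

Lemma low_at_selection {R : realType} {n : nat} (w : interval_game R n)
    (U : {set 'I_n}) : selection w (low_at w U).
Proof.
apply/selectionP => S /=; rewrite /low_at_worth.
by case: ifP; rewrite lexx lower_le_upper.
Qed.

(** Equality would give [B \subset A], so [B] would be [A :&: B], which is empty. *)
Lemma disjoint_neq_setU {T : finType} {A B : {set T}} :
  A :&: B = set0 -> B <> set0 -> A != A :|: B.
Proof.
move=> AB0 B0; apply/eqP => AU; apply: B0.
by rewrite -AB0; apply/esym/setIidPr; rewrite AU subsetUr.
Qed.

Theorem theorem3 (R : realType) (n : nat) (w : interval_game R n) :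
  selection_superadditive w <->
  (forall S T : {set 'I_n}, S :&: T = set0 -> S <> set0 -> T <> set0 ->
     upper (w S) + upper (w T) <= lower (w (S :|: T))).
Proof.
split=> [sup S T ST0 S0 T0 | le_w v /selectionP vw S T ST0].
  have := sup _ (low_at_selection w (S :|: T)) S T ST0.
  rewrite /= /low_at_worth eqxx (negPf (disjoint_neq_setU ST0 T0)).
  have TS0 : T :&: S = set0 by rewrite setIC.
  by rewrite (setUC S T) (negPf (disjoint_neq_setU TS0 S0)) addrC.
(* The bound [le_w] says nothing about empty coalitions; there superadditivity is an equality
   because [v set0 = 0]. *)
have [->|/eqP S0] := eqVneq S set0; first by rewrite worth_set0 addr0 set0U.
have [->|/eqP T0] := eqVneq T set0; first by rewrite worth_set0 add0r setU0.
have /andP[_ vS] := vw S; have /andP[_ vT] := vw T.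
have /andP[vU _] := vw (S :|: T).
by rewrite addrC (le_trans (lerD vS vT)) // (le_trans (le_w S T ST0 S0 T0)).
Qed.
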